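(* Let $\Omega\subset\mathbb{R}^2$ be a non-degenerate closed triangle and let $f$ be a Riemann integrable function on $\Omega$. For each $N\ge1$ let $\mathcal{P}_N=(\boldsymbol{x}_{N,1},\boldsymbol{x}_{N,2},\dots,\boldsymbol{x}_{N,N})$ with $\boldsymbol{x}_{N,i}\in\Omega$. If $\lim_{N\to\infty}D_N^{\mathrm{P}}(\mathcal{P}_N;\Omega)=0$, then $$\lim_{N\to\infty}\frac{\mathbf{vol}(\Omega)}{N}\sum_{i=1}^N f(\boldsymbol{x}_{N,i})=\int_\Omega f(\boldsymbol{x})\,\mathrm{d}\boldsymbol{x}.$$
   Context: For non-collinear points $A,B,C$, $\Delta(A,B,C)=\{\omega_1A+\omega_2B+\omega_3C : \omega_j\ge 0,\ \omega_1+\omega_2+\omega_3=1\}$ is the closed triangle they span; $\mathbf{vol}$ is two-dimensional Lebesgue measure. Riemann integrability on a triangle. Let $T=\Delta(A,B,C)\subset\mathbb{R}^2$ be a non-degenerate closed triangle. Joining the midpoints of the sides divides $T$ into $4$ congruent triangles similar to $T$; iterating $k$ times gives, for each $k\ge0$, the decomposition of $T$ into $4^k$ congruent triangles $T_{k,1},\dots,T_{k,4^k}$, each similar to $T$. A bounded function $f:T\to\mathbb{R}$ is Riemann integrable on $T$ if $\lim_{k\to\infty}4^{-k}\sum_{i=1}^{4^k}f(\boldsymbol{x}_{k,i})=\mu\in\mathbb{R}$ exists for any choices of $\boldsymbol{x}_{k,i}\in T_{k,i}$ (with $\mu$ not depending on the choices); then $\int_T f(\boldsymbol{x})\,\mathrm{d}\boldsymbol{x}=\mu\,\mathbf{vol}(T)$.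 Parallelogram discrepancy. Let $\Omega=\Delta(A,B,C)$. For $a,b\in(0,1]$ let $\mathcal{T}_{a,b,C}=\{C+s(A-C)+t(B-C): 0\le s\le a,\ 0\le t\le b\}$ be the parallelogram with vertex $C$ and side vectors $a(A-C)$, $b(B-C)$. Let $\mathcal{S}_C=\{\mathcal{T}_{a,b,C}: 0<a\le 1,\ 0<b\le 1\}$, define $\mathcal{S}_A,\mathcal{S}_B$ analogously (vertex $A$, resp. $B$, with side vectors along the two triangle sides leaving that vertex), and $\mathcal{S}_{\mathrm{P}}=\mathcal{S}_A\cup\mathcal{S}_B\cup\mathcal{S}_C$. For a list $\mathcal{P}=(\boldsymbol{x}_1,\dots,\boldsymbol{x}_N)$ of points of $\Omega$ and a measurable set $S$, put $\delta_N(S;\mathcal{P},\Omega)=\mathbf{vol}(S\cap\Omega)/\mathbf{vol}(\Omega)-\frac1N\sum_{i=1}^N 1_{\boldsymbol{x}_i\in S}$. Then $D_N^{\mathrm{P}}(\mathcal{P};\Omega)=\sup_{S\in\mathcal{S}_{\mathrm{P}}}|\delta_N(S;\mathcal{P},\Omega)|$. *)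

(* Defs.v *)
From HB Require Import structures.
From mathcomp Require Import all_boot all_order all_algebra.
From mathcomp Require Import all_classical all_reals all_analysis.

Set Implicit Arguments.
Unset Strict Implicit.
Unset Printing Implicit Defensive.
Import Order.TTheory GRing.Theory Num.Theory.
Import numFieldNormedType.Exports.

Local Open Scope classical_set_scope.
Local Open Scope ring_scope.

Section Defs.
Context {R : realType}.

Local Notation pt := (R * R)%type.
Local Notation triple := (pt * pt * pt)%type.

Definition collinear (A B C : pt) : Prop :=
  exists p v : pt, v != 0 /\
    forall X, [set A; B; C] X -> exists t : R, X = p + t *: v.

Definition triangle (A B C : pt) : set pt :=
  [set p | exists w1 w2 w3 : R,
     [/\ 0 <= w1, 0 <= w2, 0 <= w3, w1 + w2 + w3 = 1
       & p = w1 *: A + w2 *: B + w3 *: C]].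

Definition vol (S : set pt) : R :=
  fine ((@lebesgue_measure R \x @lebesgue_measure R)%E S).

Definition midpoint (P Q : pt) : pt := 2^-1 *: (P + Q).

Definition split4 (t : triple) : seq triple :=
  let: (A, B, C) := t in
  [:: (A, midpoint A B, midpoint A C);
      (midpoint A B, B, midpoint B C);
      (midpoint A C, midpoint B C, C);
      (midpoint A B, midpoint B C, midpoint A C)].

Fixpoint subdivision (k : nat) (A B C : pt) : seq triple :=
  if k is k'.+1 then flatten [seq split4 t | t <- subdivision k' A B C]
  else [:: (A, B, C)].

Lemma size_subdivision k A B C : size (subdivision k A B C) = (4 ^ k)%N.
Proof.
elim: k => // k IH; rewrite expnSr -{}IH /=.
by elim: (subdivision k A B C) => //= -[[P Q] U] s IHs; rewrite /= IHs mulSn.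
Qed.

(* Indices run from 0; the default value of [nth] is never reached for
   [i < 4 ^ k], by [size_subdivision]. *)
Definition subtriangle (A B C : pt) (k i : nat) : set pt :=
  let: (P, Q, U) := nth (A, B, C) (subdivision k A B C) i in triangle P Q U.

Definition riemann_mean (A B C : pt) (f : pt -> R) (mu : R) : Prop :=
  forall x : nat -> nat -> pt,
    (forall k i, (i < 4 ^ k)%N -> subtriangle A B C k i (x k i)) ->
    (fun k : nat => (4 ^+ k)^-1 * \sum_(i < 4 ^ k) f (x k i)) @ \oo --> mu.

(* A function on the triangle is represented by a total function on the plane
   whose values off the triangle are never used. *)
Definition riemann_integrable (A B C : pt) (f : pt -> R) : Prop :=
  (exists M : R, forall p, triangle A B C p -> `|f p| <= M) /\
  (exists mu : R, riemann_mean A B C f mu).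

(* The value mu is unique when it exists; otherwise the default 0 is used. *)
Definition riemann_integral (A B C : pt) (f : pt -> R) : R :=
  xget 0 [set mu | riemann_mean A B C f mu] * vol (triangle A B C).

Definition parallelogram (V P Q : pt) (a b : R) : set pt :=
  [set p | exists s t : R,
     [/\ 0 <= s <= a, 0 <= t <= b & p = V + s *: (P - V) + t *: (Q - V)]].

Definition parallelograms_at (V P Q : pt) : set (set pt) :=
  [set S | exists a b : R,
     [/\ 0 < a <= 1, 0 < b <= 1 & S = parallelogram V P Q a b]].

Definition parallelograms (A B C : pt) : set (set pt) :=
  parallelograms_at A B C `|` parallelograms_at B C A
    `|` parallelograms_at C A B.

Definition local_discrepancy (Omega : set pt) (N : nat) (P : N.-tuple pt)
    (S : set pt) : R :=
  vol (S `&` Omega) / vol Omega - N%:R^-1 * \sum_(i < N) \1_S (tnth P i).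

(* For N >= 1 the local discrepancies are bounded by 1, so that this real
   supremum is the genuine one. *)
Definition parallelogram_discrepancy (A B C : pt) (N : nat)
    (P : N.-tuple pt) : R :=
  sup [set `|local_discrepancy (triangle A B C) P S| |
        S in parallelograms A B C].

End Defs.

(* Main.v *)
Require Import Defs.
From HB Require Import structures.
From mathcomp Require Import all_boot all_order all_algebra.
From mathcomp Require Import all_classical all_reals all_analysis.
From mathcomp Require Import measurable_realfun ring lra.
Import Order.TTheory GRing.Theory Num.Theory.
Import numFieldNormedType.Exports.
Local Open Scope classical_set_scope.
Local Open Scope ring_scope.

Set Implicit Arguments.
Unset Strict Implicit.
Unset Printing Implicit Defensive.

(* Only the parallelograms at the vertex C are needed.  In the affine
   coordinates (alpha, beta) of the frame (C; A - C, B - C) they are, inside the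
   triangle, the quadrants {alpha <= a, beta <= b}, so the discrepancy hypothesis
   is convergence of the joint distribution function, and inclusion-exclusion
   gives the limiting frequency of every half-open cell.  By translation
   invariance the area of a cell is bilinear in its sides, and by point
   reflection the unit cell has at most twice the area of the triangle; so a cell
   with sides w, h has limiting frequency at most 2 w h.  Covering a homothetic
   copy of ratio r by thin columns shows that its limiting frequency is at most
   r ^ 2, i.e. 4 ^ - k for the triangles of the k-th subdivision.  Such upper
   bounds suffice: f + M >= 0 is at most the sum over these triangles of their
   upper bounds for f + M times their indicators, so the limsup of the averages
   of f is at most an upper Riemann sum up to epsilon.  The same applies to - f. *)

(** * Translations and reflections of the plane *)

Section planar_measure.
Context {R : realType}.
Local Notation mu := (@lebesgue_measure R).
Local Notation plane := (measurableTypeR R * measurableTypeR R)%type.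
Local Notation lam := (mu \x mu)%E.

Lemma measurable_fun_addl (v : R) :
  measurable_fun setT ((fun x => v + x) : measurableTypeR R -> measurableTypeR R).
Proof. by apply: measurable_funD => //; exact: measurable_cst. Qed.

(** The translated measure agrees with [mu] on half-open intervals, and these determine Lebesgue
    measure. *)
Lemma lebesgue_measure_addl (v : R) (S : set (measurableTypeR R)) :
  measurable S -> mu ((fun x => v + x) @^-1` S) = mu S.
Proof.
move=> mS; have mv := measurable_fun_addl v.
pose nu := pushforward mu ((fun x => v + x) : measurableTypeR R -> measurableTypeR R).
suff : mu S = nu S by [].
apply: lebesgue_measure_unique => //= _ [[a b]] _ <-; rewrite /nu /pushforward /=.
have -> : (fun x => v + x) @^-1` `]a, b]%classic = `]a - v, b - v]%classic.
  by apply/seteqP; split => x /=; rewrite !in_itv/= => /andP[? ?]; apply/andP; split; lra.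
rewrite !lebesgue_measure_itv/= !lte_fin.
have -> : (a - v < b - v) = (a < b) by rewrite ltrD2r.
by case: ifP => // _; rewrite -!EFinB; congr (_%:E); lra.
Qed.

Lemma lebesgue_measure_subl (v : R) (S : set (measurableTypeR R)) :
  measurable S -> mu ((fun x => v - x) @^-1` S) = mu S.
Proof.
move=> mS; have mv := measurable_fun_addl v.
have mvS : measurable ((fun x => v + x) @^-1` S : set (measurableTypeR R)).
  by rewrite -[X in measurable X]setTI; exact: mv.
by rewrite -[RHS](lebesgue_measure_addl v) // -[RHS]lebesgue_measureN.
Qed.

(** A product measure is determined by its values on measurable rectangles, and the preimage of a
    rectangle is a rectangle whose sides have the same measures. *)
Lemma plane_measure_map (g h : measurableTypeR R -> measurableTypeR R)
    (S : set plane) :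
  measurable_fun setT g -> measurable_fun setT h ->
  (forall T : set (measurableTypeR R), measurable T -> mu (g @^-1` T) = mu T) ->
  (forall T : set (measurableTypeR R), measurable T -> mu (h @^-1` T) = mu T) ->
  measurable S -> lam ((fun p => (g p.1, h p.2)) @^-1` S) = lam S.
Proof.
move=> mg mh gE hE mS.
have mgh : measurable_fun setT ((fun p => (g p.1, h p.2)) : plane -> plane).
  by apply: measurable_fun_pair; [exact: measurableT_comp mg _|exact: measurableT_comp mh _].
pose nu := pushforward lam ((fun p => (g p.1, h p.2)) : plane -> plane).
suff : lam S = nu S by [].
apply: product_measure_unique => //= T U mT mU; rewrite /nu /pushforward /=.
have -> : (fun p => (g p.1, h p.2)) @^-1` (T `*` U) = (g @^-1` T) `*` (h @^-1` U) by [].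
have mgT : measurable (g @^-1` T) by rewrite -[X in measurable X]setTI; exact: mg.
have mhU : measurable (h @^-1` U) by rewrite -[X in measurable X]setTI; exact: mh.
rewrite -[in RHS](gE T) // -[in RHS](hE U) //.
exact: product_measure1E.
Qed.

Lemma plane_measure_translate (v : R * R) (S : set plane) :
  measurable S -> lam ((fun p => v + p) @^-1` S) = lam S.
Proof.
by apply: (@plane_measure_map (fun x => v.1 + x) (fun x => v.2 + x)) => //;
  [exact: measurable_fun_addl|exact: measurable_fun_addl| |]; exact: lebesgue_measure_addl.
Qed.

Lemma plane_measure_reflect (v : R * R) (S : set plane) :
  measurable S -> lam ((fun p => v - p) @^-1` S) = lam S.
Proof.
have m w : measurable_fun setT ((fun x => w - x) : measurableTypeR R -> measurableTypeR R).
  by apply: measurable_funB => //; exact: measurable_cst.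
by apply: (@plane_measure_map (fun x => v.1 - x) (fun x => v.2 - x)) => //;
  exact: lebesgue_measure_subl.
Qed.

End planar_measure.

(** * Affine coordinates and areas of cells *)

Section additive_functions.
Context {R : realType}.

(** Additivity and nonnegativity make [phi] monotone, so [n phi(w) = phi(n w) <= (n w + 1) phi(1)]
    for every [n]; dividing by a large [n] leaves the claim. *)
Lemma additive_ge0_le (phi : R -> R) (w : R) :
  (forall s t, 0 <= s -> 0 <= t -> phi (s + t) = phi s + phi t) ->
  (forall s, 0 <= s -> 0 <= phi s) -> 0 <= w -> phi w <= w * phi 1.
Proof.
move=> phiD phi_ge0 w_ge0.
have phiMn n s : 0 <= s -> phi (n%:R * s) = n%:R * phi s.
  move=> s_ge0; elim: n => [|n IH].
    by rewrite !mul0r; have := phiD 0 0 (lexx 0) (lexx 0); rewrite addr0; lra.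
  by rewrite -natr1 !mulrDl !mul1r phiD ?mulr_ge0// IH.
rewrite leNgt; apply/negP => wlt.
have d_gt0 : 0 < phi w - w * phi 1 by rewrite subr_gt0.
(* This [n] makes [n + 1] times the supposed excess of [phi w] larger than [phi 1]. *)
pose n := Num.truncn (phi 1 / (phi w - w * phi 1)).
have n_gt : phi 1 < n.+1%:R * (phi w - w * phi 1).
  by rewrite -ltr_pdivrMr// truncnS_gt.
pose k := Num.truncn (n.+1%:R * w).
have nw_ge0 : 0 <= n.+1%:R * w by rewrite mulr_ge0.
have /andP[k_le k_gt] := truncn_itv nw_ge0; rewrite -/k in k_le k_gt.
have : phi (n.+1%:R * w) <= phi (k.+1%:R * 1).
  have -> : k.+1%:R * 1 = n.+1%:R * w + (k.+1%:R - n.+1%:R * w) by ring.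
  by rewrite phiD ?subr_ge0 ?(ltW k_gt)// lerDl phi_ge0// subr_ge0 ltW.
rewrite !phiMn// => le1.
have : k.+1%:R * phi 1 <= (n.+1%:R * w + 1) * phi 1.
  by apply: ler_wpM2r; [exact: phi_ge0|rewrite -natr1 lerD2r].
by move: n_gt le1; lra.
Qed.

(** Finiteness at 1 spreads to the positive integers by additivity and to all [s >= 0] by
    monotonicity, which reduces the claim to the real case. *)
Lemma additive_ge0_lee (phi : R -> \bar R) (w : R) :
  (forall s t, 0 <= s -> 0 <= t -> phi (s + t) = (phi s + phi t)%E) ->
  (forall s, 0 <= s -> (0 <= phi s)%E) -> (phi 1%R < +oo)%E -> 0 <= w ->
  (phi w <= w%:E * phi 1%R)%E.
Proof.
move=> phiD phi_ge0 phi1 w_ge0.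
have phi_nat n : (phi n.+1%:R%R < +oo)%E.
  elim: n => // n IH; rewrite -natr1 phiD//.
  exact: lte_add_pinfty.
have phi_fin s : 0 <= s -> phi s \is a fin_num.
  move=> s_ge0; rewrite ge0_fin_numE ?phi_ge0//.
  apply: le_lt_trans (phi_nat (Num.truncn s)).
  have s_lt := ltW (truncnS_gt s).
  have -> : (Num.truncn s).+1%:R = s + ((Num.truncn s).+1%:R - s) by ring.
  by rewrite phiD ?subr_ge0// leeDl// phi_ge0// subr_ge0.
rewrite -(fineK (phi_fin _ w_ge0)) -(fineK (phi_fin _ (@ler01 R))) -EFinM lee_fin.
apply: (@additive_ge0_le (fine \o phi)) => //= [s t s0 t0|s s0].
  by rewrite phiD// fineD ?phi_fin.
exact/fine_ge0/phi_ge0.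
Qed.

End additive_functions.

Section coordinates.
Context {R : realType}.
Implicit Types (A B C p q u v : R * R) (a b s t w h : R).
Local Notation plane := (measurableTypeR R * measurableTypeR R)%type.
Local Notation lam := (@lebesgue_measure R \x @lebesgue_measure R)%E.

Definition det2 u v : R := u.1 * v.2 - u.2 * v.1.

Lemma pair_ext p q : p.1 = q.1 -> p.2 = q.2 -> p = q.
Proof. by case: p q => [? ?] [? ?] /= -> ->. Qed.

(** Together with [pair_ext], these rules turn an equation between points into two equations between
    reals, for [ring] and [field]. *)
Lemma planeE :
  ((forall p q, ((p + q).1 = p.1 + q.1)%R) * (forall p q, ((p + q).2 = p.2 + q.2)%R) *
   (forall p, ((- p).1 = - p.1)%R) * (forall p, ((- p).2 = - p.2)%R) *
   (forall s p, ((s *: p).1 = s * p.1)%R) * (forall s p, ((s *: p).2 = s * p.2)%R))%type.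
Proof. by []. Qed.

Lemma det2_neq0 A B C : ~ collinear A B C -> det2 (A - C) (B - C) != 0.
Proof.
move=> ncol; apply/negP => /eqP det0; apply: ncol.
have [AC|AC] := eqVneq (A - C) 0.
  have [BC|BC] := eqVneq (B - C) 0.
    (* The three points coincide, so any nonzero direction serves. *)
    exists C, (1, 0); split=> [|X XABC].
      by apply/eqP => -[/eqP]; rewrite oner_eq0.
    exists 0; rewrite scale0r addr0.
    by case: XABC => [[|]|] -> //; apply/eqP; rewrite -subr_eq0 ?AC ?BC.
  exists C, (B - C); split=> // X [[|]|] ->.
  - by exists 0; rewrite scale0r addr0; apply/eqP; rewrite -subr_eq0 AC.
  - by exists 1; rewrite scale1r addrC subrK.
  - by exists 0; rewrite scale0r addr0.
exists C, (A - C); split=> // X [[|]|] ->.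
- by exists 1; rewrite scale1r addrC subrK.
- move: AC det0; case: A B C => [A1 A2] [B1 B2] [C1 C2].
  (* [B] is reached by dividing by whichever coordinate of [A - C] is nonzero. *)
  rewrite -pair_eqE /det2 /= negb_and => /orP[] /= nz det0.
  + exists ((B1 - C1) / (A1 - C1)); apply: pair_ext; rewrite !planeE /=; first by field.
    by rewrite mulrAC (_ : (B1 - C1) * (A2 - C2) = (B2 - C2) * (A1 - C1)) ?mulfK//; lra.
  + exists ((B2 - C2) / (A2 - C2)); apply: pair_ext; rewrite !planeE /=; last by field.
    by rewrite mulrAC (_ : (B2 - C2) * (A1 - C1) = (B1 - C1) * (A2 - C2)) ?mulfK//; lra.
- by exists 0; rewrite scale0r addr0.
Qed.

(** Cyclic invariance carries facts proved in the frame at [C] over to the frames at [A] and [B]. *)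
Lemma det2_cycle A B C : det2 (B - A) (C - A) = det2 (A - C) (B - C).
Proof. by rewrite /det2 !planeE; ring. Qed.

(* By Cramer's rule, [acoord] and [bcoord] are the coordinates with respect to
   the affine frame [(C; A - C, B - C)]. *)
Definition acoord A B C p : R := det2 (p - C) (B - C) / det2 (A - C) (B - C).
Definition bcoord A B C p : R := det2 (A - C) (p - C) / det2 (A - C) (B - C).

Definition frame A B C s t : R * R := C + s *: (A - C) + t *: (B - C).

Section frame.
Variables A B C : R * R.
Hypothesis ABC : det2 (A - C) (B - C) != 0.

Local Notation al := (acoord A B C).
Local Notation be := (bcoord A B C).
Local Notation fr := (frame A B C).

Lemma coordK p : fr (al p) (be p) = p.
Proof.
move: ABC; rewrite /acoord /bcoord /frame /det2 !planeE => nz.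
by apply: pair_ext; rewrite !planeE; field.
Qed.

Lemma acoord_frame s t : al (fr s t) = s.
Proof. by move: ABC; rewrite /acoord /frame /det2 !planeE => nz; field. Qed.

Lemma bcoord_frame s t : be (fr s t) = t.
Proof. by move: ABC; rewrite /bcoord /frame /det2 !planeE => nz; field. Qed.

Lemma measurable_acoord : measurable_fun setT (al : plane -> measurableTypeR R).
Proof.
rewrite /acoord /det2; apply: measurable_funM; last exact: measurable_cst.
apply: measurable_funB; apply: measurable_funM; try exact: measurable_cst.
  by apply: (@measurable_funB _ _ _ _ fst) => //; exact: measurable_cst.
by apply: (@measurable_funB _ _ _ _ snd) => //; exact: measurable_cst.
Qed.

Lemma measurable_bcoord : measurable_fun setT (be : plane -> measurableTypeR R).
Proof.
rewrite /bcoord /det2; apply: measurable_funM; last exact: measurable_cst.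
apply: measurable_funB; apply: measurable_funM; try exact: measurable_cst.
  by apply: (@measurable_funB _ _ _ _ snd) => //; exact: measurable_cst.
by apply: (@measurable_funB _ _ _ _ fst) => //; exact: measurable_cst.
Qed.

Lemma triangleE p : triangle A B C p <-> [/\ 0 <= al p, 0 <= be p & al p + be p <= 1].
Proof.
split=> [[w1 [w2 [w3 [w1_ge0 w2_ge0 w3_ge0 w_sum ->]]]]|[al_ge0 be_ge0 al_be]].
  have -> : w1 *: A + w2 *: B + w3 *: C = fr w1 w2.
    have -> : w3 = 1 - w1 - w2 by lra.
    by apply: pair_ext; rewrite /frame !planeE; ring.
  by rewrite acoord_frame bcoord_frame; split; lra.
exists (al p), (be p), (1 - al p - be p); split; [lra..|].
rewrite -[LHS](coordK p) /frame; move: (al p) (be p) => s t.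
by apply: pair_ext; rewrite !planeE; ring.
Qed.

Lemma parallelogramE a b p : parallelogram C A B a b p <->
  (0 <= al p <= a) && (0 <= be p <= b).
Proof.
split=> [[s [t [sa tb ->]]]|/andP[ala beb]].
  by rewrite -/(fr s t) acoord_frame bcoord_frame sa.
by exists (al p), (be p); split=> //; rewrite -[LHS](coordK p).
Qed.

(** * Quadrants and cells in affine coordinates *)

Definition quadrant a b : set plane := [set p | al p <= a /\ be p <= b].

(** Half-open in both directions, so that adjacent cells are disjoint and tile a larger cell
    exactly. *)
Definition cell a w b h : set plane :=
  [set p | a < al p <= a + w /\ b < be p <= b + h].

Lemma measurable_quadrant a b : measurable (quadrant a b).
Proof.
have -> : quadrant a b = (setT `&` [set p : plane | al p <= a]) `&`
    (setT `&` [set p : plane | be p <= b]) by rewrite !setTI.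
by apply: measurableI; apply: measurable_fun_le => //;
  try exact: measurable_cst; [exact: measurable_acoord|exact: measurable_bcoord].
Qed.

Lemma measurable_parallelogram a b : measurable (parallelogram C A B a b : set plane).
Proof.
have -> : parallelogram C A B a b = quadrant a b `&`
    ((setT `&` [set p : plane | 0 <= al p]) `&` (setT `&` [set p : plane | 0 <= be p])).
  rewrite !setTI; apply/seteqP; split=> p /=.
    by move/parallelogramE => /andP[/andP[? ?] /andP[? ?]].
  by move=> [[? ?] [? ?]]; apply/parallelogramE; apply/andP; split; apply/andP.
apply: measurableI; first exact: measurable_quadrant.
by apply: measurableI; apply: measurable_fun_le => //;
  try exact: measurable_cst; [exact: measurable_acoord|exact: measurable_bcoord].
Qed.

Lemma cellE a w b h : 0 <= w -> 0 <= h ->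
  cell a w b h =
  quadrant (a + w) (b + h) `\` (quadrant a (b + h) `|` quadrant (a + w) b).
Proof.
move=> w_ge0 h_ge0; apply/seteqP; split=> p /=.
  move=> [/andP[? ?] /andP[? ?]]; split; first by split.
  by move=> [[]|[]]; lra.
move=> [[? ?] H]; split; apply/andP; split=> //; rewrite ltNge; apply/negP => ?.
  by apply: H; left.
by apply: H; right.
Qed.

Lemma measurable_cell a w b h : 0 <= w -> 0 <= h -> measurable (cell a w b h).
Proof.
move=> w_ge0 h_ge0; rewrite cellE//.
by apply: measurableD; [|apply: measurableU]; exact: measurable_quadrant.
Qed.

Lemma measurable_triangle : measurable (triangle A B C : set plane).
Proof.
have -> : triangle A B C = (setT `&` [set p : plane | 0 <= al p]) `&`
    (setT `&` [set p : plane | 0 <= be p]) `&`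
    (setT `&` [set p : plane | al p + be p <= 1]).
  rewrite !setTI; apply/seteqP; split=> p /=; first by move/triangleE => [].
  by move=> [[? ?] ?]; apply/triangleE.
apply: measurableI; [apply: measurableI|]; apply: measurable_fun_le => //;
  try exact: measurable_cst.
- exact: measurable_acoord.
- exact: measurable_bcoord.
- by apply: measurable_funD; [exact: measurable_acoord|exact: measurable_bcoord].
Qed.

(** Translation by [a (A - C) + b (B - C)] adds [(a, b)] to the coordinates. *)
Lemma lam_cell a w b h : 0 <= w -> 0 <= h -> lam (cell a w b h) = lam (cell 0 w 0 h).
Proof.
move=> w_ge0 h_ge0; pose v := a *: (A - C) + b *: (B - C).
rewrite -(@plane_measure_translate _ v); last exact: measurable_cell.
congr (lam _); apply/seteqP.
have shift p : (al (v + p) = a + al p) * (be (v + p) = b + be p).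
  have -> : v + p = fr (a + al p) (b + be p).
    rewrite -{1}(coordK p) /v /frame; move: (al p) (be p) => s t.
    by apply: pair_ext; rewrite !planeE; ring.
  by rewrite acoord_frame bcoord_frame.
by split=> p; rewrite /cell /preimage /mkset !shift !ltrDl !lerD2l !add0r.
Qed.

(** The cell is cut where the first coordinate is [w1], and the second piece is a translate of a
    cell at the origin. *)
Lemma lam_cellDw w1 w2 h : 0 <= w1 -> 0 <= w2 -> 0 <= h ->
  lam (cell 0 (w1 + w2) 0 h) = (lam (cell 0 w1 0 h) + lam (cell 0 w2 0 h))%E.
Proof.
move=> w1_ge0 w2_ge0 h_ge0.
rewrite -(@lam_cell w1 w2 0 h)// -measureU; try exact: measurable_cell.
  congr (lam _); apply/seteqP; split=> p; rewrite /cell /= !add0r.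
    move=> [/andP[? ?] ->]; have [ale|alt] := leP (al p) w1.
      by left; split=> //; apply/andP.
    by right; split=> //; apply/andP.
  by move=> [[/andP[? ?] ->]|[/andP[? ?] ->]]; split=> //; apply/andP; split; lra.
by apply/seteqP; split=> p //; rewrite /cell /= => -[[/andP[? ?] _] [/andP[? ?] _]]; lra.
Qed.

Lemma lam_cellDh w h1 h2 : 0 <= w -> 0 <= h1 -> 0 <= h2 ->
  lam (cell 0 w 0 (h1 + h2)) = (lam (cell 0 w 0 h1) + lam (cell 0 w 0 h2))%E.
Proof.
move=> w_ge0 h1_ge0 h2_ge0.
rewrite -(@lam_cell 0 w h1 h2)// -measureU; try exact: measurable_cell.
  congr (lam _); apply/seteqP; split=> p; rewrite /cell /= !add0r.
    move=> [-> /andP[? ?]]; have [ble|blt] := leP (be p) h1.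
      by left; split=> //; apply/andP.
    by right; split=> //; apply/andP.
  by move=> [[-> /andP[? ?]]|[-> /andP[? ?]]]; split=> //; apply/andP; split; lra.
by apply/seteqP; split=> p //; rewrite /cell /= => -[[_ /andP[? ?]] [_ /andP[? ?]]]; lra.
Qed.

(** The reflection [p -> A + B - p] turns coordinates [(s, t)] into [(1 - s, 1 - t)], so it carries
    the part of the unit cell outside the triangle into the triangle. *)
Lemma lam_cell11 : (lam (cell 0 1 0 1) <= lam (triangle A B C) + lam (triangle A B C))%E.
Proof.
have mT := measurable_triangle.
rewrite -[X in (_ <= _ + X)%E](@plane_measure_reflect _ (A + B))//.
have mT' : measurable ((fun p => A + B - p) @^-1` triangle A B C : set plane).
  rewrite -[X in measurable X]setTI.
  suff : measurable_fun setT ((fun p => A + B - p) : plane -> plane) by apply.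
  by apply: measurable_fun_pair; apply: measurable_funB => //; exact: measurable_cst.
have := measureU2 lam mT mT'; apply: le_trans.
apply: le_measure; rewrite ?inE; [exact: measurable_cell|exact: measurableU|].
move=> p; rewrite /cell /= !add0r => -[/andP[? ?] /andP[? ?]].
have [ab|ab] := leP (al p + be p) 1; [left; apply/triangleE|right; apply/triangleE].
  by split=> //; exact: ltW.
have -> : A + B - p = fr (1 - al p) (1 - be p).
  rewrite -{1}(coordK p) /frame; move: (al p) (be p) => s t.
  by apply: pair_ext; rewrite !planeE; ring.
by rewrite acoord_frame bcoord_frame; split; lra.
Qed.

(** [additive_ge0_lee] is applied to one side at a time, which reduces the bound to the unit
    cell. *)
Lemma lam_cell_le a w b h : 0 <= w -> 0 <= h -> (lam (triangle A B C) < +oo)%E ->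
  (lam (cell a w b h) <=
     (w * h)%:E * (lam (triangle A B C) + lam (triangle A B C)))%E.
Proof.
move=> w_ge0 h_ge0 Tfin; rewrite lam_cell//.
have fin11 : (lam (cell 0%R 1%R 0%R 1%R) < +oo)%E.
  by apply: le_lt_trans lam_cell11 _; exact: lte_add_pinfty.
have le1 : (lam (cell 0%R 1%R 0%R h) <= h%:E * lam (cell 0%R 1%R 0%R 1%R))%E.
  apply: (@additive_ge0_lee _ (fun h => lam (cell 0 1 0 h))) => // s t s0 t0.
  exact: lam_cellDh.
have fin1 : (lam (cell 0%R 1%R 0%R h) < +oo)%E.
  apply: le_lt_trans le1 _; rewrite lte_mul_pinfty//.
have : (lam (cell 0%R w 0%R h) <= w%:E * lam (cell 0%R 1%R 0%R h))%E.
  apply: (@additive_ge0_lee _ (fun w => lam (cell 0 w 0 h))) => // s t s0 t0.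
  exact: lam_cellDw.
move/le_trans; apply; rewrite EFinM -muleA lee_wpmul2l ?lee_fin//.
by apply: le_trans le1 _; rewrite lee_wpmul2l ?lee_fin//; exact: lam_cell11.
Qed.

End frame.
End coordinates.

(** * Limsup of averages along the point sets *)

Section upper_mean.
Context {R : realType}.
Variables (x : forall N, N.-tuple (R * R)) (Omega : set (R * R)).
Hypothesis x_in : forall N (i : 'I_N), Omega (tnth (x N) i).
Implicit Types (f g : R * R -> R) (c d e : R).

Definition mean g (N : nat) : R := N%:R^-1 * \sum_(i < N) g (tnth (x N) i).

(* [limsup_N mean g N <= c], without the extended reals. *)
Definition upper_mean g c : Prop :=
  forall e, 0 < e -> \forall N \near \oo, mean g N <= c + e.

Lemma le_mean f g N : (forall p, Omega p -> f p <= g p) -> mean f N <= mean g N.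
Proof. by move=> fg; rewrite ler_wpM2l ?invr_ge0// ler_sum// => i _; exact/fg/x_in. Qed.

Lemma eq_mean f g : (forall p, Omega p -> f p = g p) -> mean f = mean g.
Proof.
move=> fg; apply/funext => N; congr (_ * _).
by apply: eq_bigr => i _; exact/fg/x_in.
Qed.

Lemma meanD f g N : mean (fun p => f p + g p) N = mean f N + mean g N.
Proof. by rewrite /mean big_split/= mulrDr. Qed.

Lemma meanZ c g N : mean (fun p => c * g p) N = c * mean g N.
Proof. by rewrite /mean -mulr_sumr mulrCA. Qed.

Lemma mean_cst c N : (0 < N)%N -> mean (fun=> c) N = c.
Proof.
move=> N_gt0; rewrite /mean sumr_const card_ord -[c *+ N]mulr_natl mulKf//.
by rewrite pnatr_eq0 -lt0n.
Qed.

Lemma upper_mean_le f g c d : (forall p, Omega p -> f p <= g p) -> c <= d ->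
  upper_mean g c -> upper_mean f d.
Proof.
move=> fg cd gc e e_gt0; near=> N.
apply: le_trans (le_mean _ fg) _; apply: (@le_trans _ _ (c + e)); last by rewrite lerD2r.
by near: N; exact: gc.
Unshelve. all: by end_near. Qed.

(** Allows the bounds for boxes, homothetic triangles and Riemann sums to be proved with an
    arbitrarily small loss. *)
Lemma upper_mean_closed g c :
  (forall e, 0 < e -> upper_mean g (c + e)) -> upper_mean g c.
Proof.
move=> gc e e_gt0; have e2 : 0 < e / 2 by rewrite divr_gt0.
by have := gc _ e2 _ e2; rewrite -addrA -splitr.
Qed.

Lemma upper_meanD f g c d : upper_mean f c -> upper_mean g d ->
  upper_mean (fun p => f p + g p) (c + d).
Proof.
move=> fc gd e e_gt0; have e2 : 0 < e / 2 by rewrite divr_gt0.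
near=> N; rewrite meanD (splitr e) addrACA lerD//.
  by near: N; exact: fc.
by near: N; exact: gd.
Unshelve. all: by end_near. Qed.

Lemma upper_meanZ a g c : 0 <= a -> upper_mean g c ->
  upper_mean (fun p => a * g p) (a * c).
Proof.
(* Dividing by [a + 1] rather than by [a] also covers [a = 0]. *)
move=> a_ge0 gc e e_gt0; have ea : 0 < e / (a + 1) by rewrite divr_gt0// ltr_wpDl.
near=> N; rewrite meanZ; apply: (@le_trans _ _ (a * (c + e / (a + 1)))).
  by rewrite ler_wpM2l//; near: N; exact: gc.
rewrite mulrDr lerD2l mulrCA ger_pMr// ler_pdivrMr ?mul1r ?ltr_wpDl//.
by rewrite lerDl.
Unshelve. all: by end_near. Qed.

Lemma upper_mean_cst c : upper_mean (fun=> c) c.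
Proof.
move=> e e_gt0; near=> N.
rewrite mean_cst ?lerDl ?(ltW e_gt0)//.
by near: N; exact: nbhs_infty_gt.
Unshelve. all: by end_near. Qed.

Lemma upper_mean_sum (I : Type) (s : seq I) (g : I -> R * R -> R) (c : I -> R) :
  (forall i, upper_mean (g i) (c i)) ->
  upper_mean (fun p => \sum_(i <- s) g i p) (\sum_(i <- s) c i).
Proof.
move=> gc; elim: s => [|i s IH].
  have -> : (fun p => \sum_(i <- [::]) g i p) = fun=> 0.
    by apply/funext => p; rewrite big_nil.
  by rewrite big_nil; exact: upper_mean_cst.
rewrite big_cons.
have -> : (fun p => \sum_(j <- i :: s) g j p) = fun p => g i p + \sum_(j <- s) g j p.
  by apply/funext => p; rewrite big_cons.
exact: upper_meanD.
Qed.

Lemma cvg_upper_mean g c : mean g @ \oo --> c -> upper_mean g c.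
Proof.
move/cvgrPdist_le => gc e e_gt0; near=> N.
by rewrite -lerBlDl; apply: le_trans (ler_norm _) _; rewrite distrC; near: N; exact: gc.
Unshelve. all: by end_near. Qed.

(** An upper bound for [- g] bounds the liminf for [g] from below, so upper estimates alone yield
    convergence. *)
Lemma upper_mean_cvg g c : upper_mean g c -> upper_mean (fun p => - g p) (- c) ->
  mean g @ \oo --> c.
Proof.
move=> gc gNc; apply/cvgrPdist_le => e e_gt0; near=> N.
rewrite ler_norml; apply/andP; split.
  by rewrite lerNl opprB lerBlDl; near: N; exact: gc.
have : mean (fun p => - g p) N <= - c + e by near: N; exact: gNc.
have -> : mean (fun p => - g p) N = - mean g N by rewrite /mean sumrN mulrN.
by lra.
Unshelve. all: by end_near. Qed.

End upper_mean.

(** * Frequencies of cells and homothetic triangles *)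

Section equidistribution.
Context {R : realType}.
Variables (A B C : R * R) (x : forall N, N.-tuple (R * R)).
Hypothesis ABC : det2 (A - C) (B - C) != 0.
Hypothesis x_in : forall N (i : 'I_N), triangle A B C (tnth (x N) i).
Hypothesis discrepancy_cvg0 :
  (fun N => parallelogram_discrepancy A B C (x N)) @ \oo --> (0 : R).
Hypothesis vol_neq0 : vol (triangle A B C) != 0.
Implicit Types (S T : set (R * R)) (p W : R * R) (a b c d w h r e : R).

Local Notation plane := (measurableTypeR R * measurableTypeR R)%type.
Local Notation lam := (@lebesgue_measure R \x @lebesgue_measure R)%E.
Local Notation Om := (triangle A B C).
Local Notation al := (acoord A B C).
Local Notation be := (bcoord A B C).
Local Notation Q := (quadrant A B C).

Let mOm := measurable_triangle ABC.

(** [fine] sends an infinite measure to 0, so a nonzero [vol] forces finiteness. *)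
Lemma lam_triangle_fin : (lam Om < +oo)%E.
Proof. by move: vol_neq0; rewrite /vol; case: (lam Om) => [u| |] //; rewrite ?ltry// eqxx. Qed.

Lemma lam_triangleE : lam Om = (vol Om)%:E.
Proof. by rewrite fineK// ge0_fin_numE// lam_triangle_fin. Qed.

Lemma vol_triangle_gt0 : 0 < vol Om.
Proof. by rewrite lt_neqAle eq_sym vol_neq0 fine_ge0. Qed.

Definition rel_vol S : R := vol (S `&` Om) / vol Om.

Lemma lamI_fin S : measurable (S : set plane) -> lam (S `&` Om) \is a fin_num.
Proof.
move=> mS; rewrite ge0_fin_numE//; apply: le_lt_trans lam_triangle_fin.
by apply: le_measure; rewrite ?inE //; exact: measurableI.
Qed.

Lemma rel_vol_ge0 S : 0 <= rel_vol S.
Proof. by rewrite divr_ge0 ?fine_ge0. Qed.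

Lemma rel_vol_le1 S : measurable (S : set plane) -> rel_vol S <= 1.
Proof.
move=> mS; rewrite ler_pdivrMr ?vol_triangle_gt0// mul1r -lee_fin -lam_triangleE.
rewrite fineK ?lamI_fin//; apply: le_measure; rewrite ?inE //; exact: measurableI.
Qed.

Lemma rel_volD S T : S `<=` T -> measurable (S : set plane) ->
  measurable (T : set plane) -> rel_vol T = rel_vol S + rel_vol (T `\` S).
Proof.
move=> ST mS mT; have mTS : measurable (T `\` S : set plane) by exact: measurableD.
rewrite /rel_vol -mulrDl; congr (_ / _).
rewrite /vol -fineD ?lamI_fin// -measureU; try exact: measurableI.
  congr (fine (lam _)); rewrite -setIUl; congr (_ `&` _).
  by rewrite setDUK.
by apply/seteqP; split=> p // [[? _] [[_ ?] _]].
Qed.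

Lemma mean_indic_le1 S N : mean x \1_S N <= 1.
Proof.
case: N => [|N]; first by rewrite /mean big_ord0 mulr0.
rewrite -[leRHS](mean_cst x 1 (ltn0Sn N)); apply: (le_mean x_in) => p _.
by rewrite indicE; case: (_ \in _).
Qed.

Lemma mean_indic_ge0 S N : 0 <= mean x \1_S N.
Proof. by rewrite mulr_ge0 ?invr_ge0// sumr_ge0// => i _; rewrite indicE. Qed.

Lemma quadrant_triangle a b : parallelogram C A B a b `&` Om = Q a b `&` Om.
Proof.
apply/seteqP; split=> p [] /=; rewrite /quadrant /=.
  by move/(parallelogramE ABC) => /andP[/andP[_ ?] /andP[_ ?]].
move=> [? ?] Op; split=> //; apply/(parallelogramE ABC).
by have [? ? _] := (triangleE ABC p).1 Op; apply/andP; split; apply/andP.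
Qed.

(** All points of the tuples lie in [Om], so only the trace of a set on [Om] counts; this exchanges
    parallelograms for quadrants. *)
Lemma eq_mean_indic S T : S `&` Om = T `&` Om -> mean x \1_S = mean x \1_T.
Proof.
move=> ST; apply: (eq_mean x_in) => p Op; rewrite !indicE; congr ((nat_of_bool _)%:R).
apply/idP/idP; rewrite !inE => Sp.
  by have [] : (T `&` Om) p by rewrite -ST.
by have [] : (S `&` Om) p by rewrite ST.
Qed.

Lemma le_discrepancy N a b : 0 < a <= 1 -> 0 < b <= 1 ->
  `|rel_vol (Q a b) - mean x \1_(Q a b) N| <= parallelogram_discrepancy A B C (x N).
Proof.
move=> a01 b01; rewrite -(eq_mean_indic (quadrant_triangle a b)).
rewrite /rel_vol -quadrant_triangle.
apply: sup_upper_bound; last first.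
  by exists (parallelogram C A B a b) => //; right; exists a, b.
split; first by eexists; exists (parallelogram C A B a b); [right; exists a, b|].
(* The whole family, at all three vertices, must be bounded: relative areas and frequencies both lie
   in [[0, 1]]. *)
exists 1 => _ [S PS <-]; rewrite /local_discrepancy -/(rel_vol S) -/(mean x \1_S N).
have mS : measurable (S : set plane).
  case: PS => [[|]|] [a' [b' [_ _ ->]]]; apply: measurable_parallelogram => //.
    by rewrite (det2_cycle A B).
  by rewrite (det2_cycle B C) det2_cycle.
have := rel_vol_le1 mS; have := mean_indic_le1 S N; have := mean_indic_ge0 S N; have := rel_vol_ge0 S.
by rewrite ler_norml => *; apply/andP; split; lra.
Qed.

Lemma cvg_rel_vol_quadrant01 a b : 0 < a <= 1 -> 0 < b <= 1 ->
  mean x \1_(Q a b) @ \oo --> rel_vol (Q a b).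
Proof.
move=> a01 b01; apply/cvgrPdist_le => e e_gt0.
move/cvgrPdist_le : discrepancy_cvg0 => /(_ _ e_gt0) disc_le; near=> N.
apply: le_trans (le_discrepancy N a01 b01) _; apply: le_trans (ler_norm _) _.
by rewrite -normrN -sub0r; near: N.
Unshelve. all: by end_near. Qed.

(** The discrepancy controls corners in [(0, 1]] only. A negative bound gives an empty trace on
    [Om], and a bound above 1 can be lowered to 1. The value 0 is left out because the
    parallelograms have positive sides. *)
Lemma cvg_rel_vol_quadrant a b : a != 0 -> b != 0 ->
  mean x \1_(Q a b) @ \oo --> rel_vol (Q a b).
Proof.
move=> a_neq0 b_neq0; have [ab|] := boolP ((0 < a) && (0 < b)); last first.
  move=> ab; have Q0 : Q a b `&` Om = set0 `&` Om.
    rewrite set0I; apply/seteqP; split=> p //= -[[pa pb] /(triangleE ABC)[? ? _]].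
    by move: ab; rewrite !lt_neqAle ![0 == _]eq_sym a_neq0 b_neq0 !andTb
      (le_trans _ pa)// (le_trans _ pb).
  rewrite (eq_mean_indic Q0) /rel_vol Q0 set0I /vol measure0 mul0r.
  have -> : mean x \1_set0 = fun=> 0; last exact: cvg_cst.
  by apply/funext => N; rewrite /mean big1 ?mulr0// => i _; rewrite indicE in_set0.
case/andP: ab => a_gt0 b_gt0.
have Qmin : Q a b `&` Om = Q (Num.min a 1) (Num.min b 1) `&` Om.
  apply/seteqP; split=> p [] [/= pa pb] pO; split=> //; split=> //=; move: pa pb;
    have [? ? ?] := (triangleE ABC p).1 pO; rewrite !le_min => *.
  - by apply/andP; split=> //; lra.
  - by apply/andP; split=> //; lra.
  - by lra.
  - by lra.
rewrite (eq_mean_indic Qmin) /rel_vol Qmin.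
by apply: cvg_rel_vol_quadrant01; rewrite lt_min ge_min lexx orbT ltr01 !andbT.
Qed.

(** * Limiting frequencies of cells, boxes and homothetic triangles *)

Local Notation cl := (cell A B C).

Lemma indic_cell a w b h p : 0 <= w -> 0 <= h ->
  \1_(cl a w b h) p = \1_(Q (a + w) (b + h)) p - \1_(Q a (b + h)) p
                      - \1_(Q (a + w) b) p + \1_(Q a b) p :> R.
Proof.
have qE c d q : (q \in Q c d) = (al q <= c) && (be q <= d).
  by apply/idP/idP; rewrite inE => /andP.
have cE c v d k q : (q \in cl c v d k) = (c < al q <= c + v) && (d < be q <= d + k).
  by apply/idP/idP; rewrite inE => /andP.
move=> w_ge0 h_ge0; rewrite !indicE !qE cE.
by case: (leP (al p) a); case: (leP (al p) (a + w)); case: (leP (be p) b);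
  case: (leP (be p) (b + h)) => /= *; try lra; rewrite ?subrr ?subr0 ?sub0r ?addr0 ?addNr.
Qed.

(** The largest quadrant splits into the cell and [U], the union of two quadrants that meet in
    [Q a b]. *)
Lemma rel_vol_cell a w b h : 0 <= w -> 0 <= h ->
  rel_vol (cl a w b h) = rel_vol (Q (a + w) (b + h)) - rel_vol (Q a (b + h))
                      - rel_vol (Q (a + w) b) + rel_vol (Q a b).
Proof.
move=> w_ge0 h_ge0; have mQ c d := measurable_quadrant A B C c d.
pose U := Q a (b + h) `|` Q (a + w) b.
have mU : measurable (U : set plane) by exact: measurableU.
have -> : rel_vol (Q (a + w) (b + h)) = rel_vol U + rel_vol (cl a w b h).
  rewrite (cellE A B C a b w_ge0 h_ge0); apply: rel_volD => //.
  by move=> p [] []; rewrite /quadrant /=; split; lra.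
have -> : rel_vol U = rel_vol (Q a (b + h)) + rel_vol (Q (a + w) b `\` Q a b).
  rewrite (@rel_volD (Q a (b + h)) U)//; last by left.
  congr (_ + rel_vol _); apply/seteqP; split=> p /=; rewrite /U /quadrant /=.
    by move=> [[//|[? ?]] H]; split=> // -[? ?]; apply: H; split=> //; lra.
  by move=> [[? ?] H]; split; [right|move=> [? ?]; apply: H].
have -> : rel_vol (Q (a + w) b) = rel_vol (Q a b) + rel_vol (Q (a + w) b `\` Q a b).
  by apply: rel_volD => // p []; rewrite /quadrant /=; split; lra.
by lra.
Qed.

Lemma rel_vol_cell_le a w b h : 0 <= w -> 0 <= h -> rel_vol (cl a w b h) <= 2 * w * h.
Proof.
move=> w_ge0 h_ge0; rewrite ler_pdivrMr ?vol_triangle_gt0// -lee_fin.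
have mc := measurable_cell A B C a b w_ge0 h_ge0.
rewrite fineK ?lamI_fin//; apply: (@le_trans _ _ (lam (cl a w b h))).
  by apply: le_measure; rewrite ?inE //; exact: measurableI.
apply: le_trans (lam_cell_le ABC a b w_ge0 h_ge0 lam_triangle_fin) _.
by rewrite lam_triangleE -EFinD -EFinM lee_fin; lra.
Qed.

(** Inclusion-exclusion makes the frequency converge to the relative area; the conditions on the
    corners are those of [cvg_rel_vol_quadrant]. *)
Lemma upper_mean_cell a w b h : 0 <= w -> 0 <= h ->
  a != 0 -> a + w != 0 -> b != 0 -> b + h != 0 ->
  upper_mean x \1_(cl a w b h) (2 * w * h).
Proof.
move=> w_ge0 h_ge0 a0 aw0 b0 bh0.
apply: (@upper_mean_le _ _ _ x_in _ \1_(cl a w b h)) (rel_vol_cell_le a b w_ge0 h_ge0) _ => //.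
apply: cvg_upper_mean; rewrite rel_vol_cell//.
have -> : mean x \1_(cl a w b h) = mean x \1_(Q (a + w) (b + h))
   \- mean x \1_(Q a (b + h)) \- mean x \1_(Q (a + w) b) \+ mean x \1_(Q a b).
  apply/funext => N; rewrite /= /mean -!mulrBr -mulrDr -!sumrB -big_split/=.
  by congr (_ * _); apply: eq_bigr => i _; exact: indic_cell.
by apply: cvgD; [apply: cvgB; [apply: cvgB|]|]; exact: cvg_rel_vol_quadrant.
Qed.

Lemma near0_addr_neq0 a : \forall d \near (0 : R)^'+, a + d != 0.
Proof.
have [a_lt0|a_ge0] := ltP a 0; near=> d; rewrite neq_lt.
  apply/orP; left; rewrite -ltrBrDl sub0r; near: d.
  by apply: nbhs_right_lt; rewrite oppr_gt0.
by apply/orP; right; rewrite ltr_wpDl//; near: d; exact: nbhs_right_gt.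
Unshelve. all: by end_near. Qed.

(** The closed box lies in a half-open cell enlarged by [t] on every side, and a small [t] keeps the
    corner coordinates nonzero. The box has sides [2 w] and [2 h], hence [8 w h]. *)
Lemma upper_mean_box c d w h : 0 <= w -> 0 <= h ->
  upper_mean x \1_[set p | `|al p - c| <= w /\ `|be p - d| <= h] (8 * w * h).
Proof.
move=> w_ge0 h_ge0; apply: upper_mean_closed => e e_gt0.
(* For [t <= 1], [8 (w + t) (h + t)] exceeds [8 w h] by at most [t (8 w + 8 h + 8)]. *)
have pos : 0 < 8 * w + 8 * h + 8 by lra.
near (0 : R)^'+ => t.
have t_gt0 : 0 < t by near: t; exact: nbhs_right_gt.
have t_le1 : t <= 1 by near: t; apply: nbhs_right_le.
have t_le : t * (8 * w + 8 * h + 8) <= e.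
  by rewrite -ler_pdivlMr//; near: t; apply: nbhs_right_le; rewrite divr_gt0.
have cw : c - w - t != 0.
  rewrite (_ : c - w - t = - (w - c + t)) ?oppr_eq0; last by lra.
  by near: t; exact: near0_addr_neq0.
have cw' : c - w - t + (2 * w + 2 * t) != 0.
  rewrite (_ : _ - t + _ = c + w + t); last by lra.
  by near: t; exact: near0_addr_neq0.
have dh : d - h - t != 0.
  rewrite (_ : d - h - t = - (h - d + t)) ?oppr_eq0; last by lra.
  by near: t; exact: near0_addr_neq0.
have dh' : d - h - t + (2 * h + 2 * t) != 0.
  rewrite (_ : _ - t + _ = d + h + t); last by lra.
  by near: t; exact: near0_addr_neq0.
have wt : 0 <= 2 * w + 2 * t by lra.
have ht : 0 <= 2 * h + 2 * t by lra.
apply: (upper_mean_le x_in _ _ (upper_mean_cell wt ht cw cw' dh dh')).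
  move=> p _; rewrite !indicE ler_nat; case: (boolP (p \in _)) => // pin.
  rewrite mem_set//.
  move: pin; rewrite inE /= => -[]; rewrite !ler_norml => /andP[? ?] /andP[? ?].
  by split; apply/andP; split; lra.
have : t * t <= t by rewrite ger_pMr.
by move: t_le; rewrite !mulrDr; nra.
Unshelve. all: by end_near. Qed.

Lemma sum_subr (m : R) k :
  \sum_(i < k) (m - i%:R) = k%:R * m - k%:R * (k%:R - 1) / 2.
Proof.
elim: k => [|k IH]; first by rewrite big_ord0; lra.
by rewrite big_ord_recr/= IH -natr1; field.
Qed.

(* The triangle is covered by [m + 1] thin columns of width [r / m]. *)
Lemma upper_mean_homothetic a b r T :
  (forall p, T p -> exists s t,
    [/\ 0 <= s, 0 <= t, s + t <= 1, al p = a + r * s & be p = b + r * t]) ->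
  upper_mean x \1_T (r ^+ 2).
Proof.
move=> Tsub; apply: upper_mean_closed => e e_gt0.
(* The bounds for the columns will add up to [r ^ 2 + r ^ 2 / m], so [m] is chosen to make the
   excess at most [e]. *)
pose n := Num.truncn (r ^+ 2 / e).
pose m : R := n.+1%:R.
have m_gt0 : 0 < m by [].
have rm : r ^+ 2 / m <= e.
  by rewrite ler_pdivrMr// mulrC -ler_pdivrMr//; exact/ltW/truncnS_gt.
(* [w] and [h i] are the half-sides, [c i] and [d i] the centre, of the column
   [i / m <= s <= (i + 1) / m], [0 <= t <= 1 - i / m]. The ratio [r] may be negative, hence the
   absolute values. *)
pose w : R := `|r| / (2 * m).
pose h (i : 'I_n.+2) : R := `|r| * (m - i%:R) / (2 * m).
have w_ge0 : 0 <= w by rewrite divr_ge0// mulr_ge0// ltW.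
have h_ge0 i : 0 <= h i.
  rewrite divr_ge0 ?mulr_ge0 ?(ltW m_gt0)// subr_ge0 ler_nat.
  by rewrite -ltnS ltn_ord.
pose c (i : 'I_n.+2) : R := a + r * (i%:R + 2^-1) / m.
pose d (i : 'I_n.+2) : R := b + r * (m - i%:R) / (2 * m).
have := upper_mean_sum (index_enum 'I_n.+2)
  (fun i => upper_mean_box (c i) (d i) w_ge0 (h_ge0 i)).
apply: (upper_mean_le x_in) => [p Op|].
  rewrite [leLHS]indicE; case: (boolP (p \in T)) => [|_]; last first.
    by apply: sumr_ge0 => i _; rewrite indicE.
  rewrite inE => /Tsub[s [t [s_ge0 t_ge0 st alE beE]]].
  have ms_ge0 : 0 <= m * s by rewrite mulr_ge0// ltW.
  have /andP[k_le k_gt] := truncn_itv ms_ge0.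
  set k := Num.truncn (m * s) in k_le k_gt.
  (* The case [s = 1] gives [k = n + 1], so a last column of height 0 is included. *)
  have k_lt : (k < n.+2)%N.
    rewrite ltnS -(ler_nat R); apply: le_trans k_le _.
    by rewrite ger_pMr//; lra.
  rewrite (bigD1 (Ordinal k_lt))//= -[leLHS]addr0 lerD//; last first.
    by apply: sumr_ge0 => i _; rewrite indicE.
  rewrite indicE mem_set//= alE beE.
  have m_neq0 : m != 0 by rewrite gt_eqF.
  have m2_gt0 : 0 < 2 * m by rewrite mulr_gt0.
  have -> : a + r * s - c (Ordinal k_lt) = r * ((2 * (m * s) - 2 * k%:R - 1) / (2 * m)).
    by rewrite /c /=; field.
  have -> : b + r * t - d (Ordinal k_lt) = r * ((2 * (m * t) - (m - k%:R)) / (2 * m)).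
    by rewrite /d /=; field.
  have mt_ge0 : 0 <= m * t by rewrite mulr_ge0// ltW.
  have mst : m * s + m * t <= m by rewrite -mulrDr ger_pMr.
  rewrite -natr1 in k_gt.
  have -> : w = `|r| * (1 / (2 * m)) by rewrite /w mulrA mulr1.
  have -> : h (Ordinal k_lt) = `|r| * ((m - k%:R) / (2 * m)) by rewrite /h mulrA.
  rewrite !normrM; split; apply: ler_wpM2l => //; rewrite normfV (gtr0_norm m2_gt0)
    ler_pM2r ?invr_gt0// ler_norml; apply/andP; split; lra.
have -> : \sum_i 8 * w * h i = 8 * w * (`|r| / (2 * m)) * \sum_(i < n.+2) (m - i%:R).
  by rewrite mulr_sumr; apply: eq_bigr => i _; rewrite /h; ring.
(* Over the [m + 1] columns the numbers [m - i] add up to [m (m + 1) / 2]. *)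
have -> : 8 * w * (`|r| / (2 * m)) * \sum_(i < n.+2) (m - i%:R) = r ^+ 2 + r ^+ 2 / m.
  rewrite sum_subr /w -[r ^+ 2]real_normK ?num_real// -natr1 -/m.
  by field; rewrite gt_eqF.
by rewrite lerD2l.
Qed.

End equidistribution.

(** * Subdivisions *)

Section subdivision.
Context {R : realType}.
Implicit Types (A B C P Q U V W p : R * R) (r e : R).

Lemma triangle_cycle P Q U : triangle P Q U = triangle Q U P.
Proof.
apply/seteqP; split=> p [w1 [w2 [w3 [? ? ? ? ->]]]].
  by exists w2, w3, w1; split=> //; [lra|rewrite -addrA addrC].
by exists w3, w1, w2; split=> //; [lra|rewrite addrC addrA].
Qed.

Lemma triangle_vertex P Q U : triangle P Q U P.
Proof. by exists 1, 0, 0; split=> //; [lra|rewrite scale1r !scale0r !addr0]. Qed.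

Definition tri (t : (R * R) * (R * R) * (R * R)) : set (R * R) :=
  triangle t.1.1 t.1.2 t.2.

(** A point with a barycentric coordinate above 1/2 lies in the corner triangle at that vertex; if
    there is none, it lies in the central triangle. *)
Lemma triangle_split4 P Q U p :
  triangle P Q U p <-> exists2 t, t \in split4 (P, Q, U) & tri t p.
Proof.
split=> [[w1 [w2 [w3 [w1_ge0 w2_ge0 w3_ge0 w_sum ->]]]]|].
  have [w1_le|w1_gt] := leP w1 2^-1; last first.
    exists (P, midpoint P Q, midpoint P U); first by rewrite !inE eqxx.
    exists (w1 - w2 - w3), (2 * w2), (2 * w3); split; [lra|lra|lra|lra|].
    by rewrite /midpoint /=; apply: pair_ext; rewrite !planeE; field.
  have [w2_le|w2_gt] := leP w2 2^-1; last first.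
    exists (midpoint P Q, Q, midpoint Q U); first by rewrite !inE eqxx orbT.
    exists (2 * w1), (w2 - w1 - w3), (2 * w3); split; [lra|lra|lra|lra|].
    by rewrite /midpoint /=; apply: pair_ext; rewrite !planeE; field.
  have [w3_le|w3_gt] := leP w3 2^-1; last first.
    exists (midpoint P U, midpoint Q U, U); first by rewrite !inE eqxx !orbT.
    exists (2 * w1), (2 * w2), (w3 - w1 - w2); split; [lra|lra|lra|lra|].
    by rewrite /midpoint /=; apply: pair_ext; rewrite !planeE; field.
  exists (midpoint P Q, midpoint Q U, midpoint P U); first by rewrite !inE eqxx !orbT.
  (* The weight of each midpoint is 1 minus twice the weight of the vertex opposite to it. *)
  exists (w1 + w2 - w3), (w2 + w3 - w1), (w1 + w3 - w2); split; [lra|lra|lra|lra|].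
  by rewrite /midpoint /=; apply: pair_ext; rewrite !planeE; field.
move=> [t]; rewrite !inE => /or4P[] /eqP -> [w1 [w2 [w3 [? ? ? ? ->]]]] /=.
- exists (w1 + w2 / 2 + w3 / 2), (w2 / 2), (w3 / 2); split; [lra|lra|lra|lra|].
  by rewrite /midpoint; apply: pair_ext; rewrite !planeE; field.
- exists (w1 / 2), (w1 / 2 + w2 + w3 / 2), (w3 / 2); split; [lra|lra|lra|lra|].
  by rewrite /midpoint; apply: pair_ext; rewrite !planeE; field.
- exists (w1 / 2), (w2 / 2), (w1 / 2 + w2 / 2 + w3); split; [lra|lra|lra|lra|].
  by rewrite /midpoint; apply: pair_ext; rewrite !planeE; field.
- exists (w1 / 2 + w3 / 2), (w1 / 2 + w2 / 2), (w2 / 2 + w3 / 2); split; [lra|lra|lra|lra|].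
  by rewrite /midpoint; apply: pair_ext; rewrite !planeE; field.
Qed.

Lemma triangle_subdivision k A B C p :
  triangle A B C p <-> exists2 t, t \in subdivision k A B C & tri t p.
Proof.
elim: k p => [|k IH] p.
  by split=> [?|[t]]; [exists (A, B, C); rewrite ?inE|rewrite inE => /eqP ->].
rewrite IH; split=> [[t tk tp]|[t /flatten_mapP[s sk ts] tp]].
  have : tri t p by []. rewrite [t]surjective_pairing [t.1]surjective_pairing.
  move=> /triangle_split4[s st sp]; exists s => //; apply/flatten_mapP; exists t => //.
  by rewrite [t]surjective_pairing [t.1]surjective_pairing.
exists s => //; apply/triangle_split4; exists t => //.
by move: ts; rewrite {1}[s]surjective_pairing {1}[s.1]surjective_pairing.
Qed.

(* The central triangle of a subdivision is the image of the whole one under a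
   homothety of negative ratio, with its vertices listed in another order. *)
Definition homothetic A B C r (t : (R * R) * (R * R) * (R * R)) : Prop :=
  exists W, let: (A', B', C') := (W + r *: A, W + r *: B, W + r *: C) in
    [\/ t = (A', B', C'), t = (B', C', A') | t = (C', A', B')].

(** A corner triangle keeps the order of the vertices. Since
    [(A + B) / 2 = (A + B + C) / 2 - C / 2], the central triangle is a copy of ratio [- r / 2]
    shifted by [(r / 2) (A + B + C)], with its vertices permuted cyclically. *)
Lemma homothetic_split4 A B C r t s : homothetic A B C r t -> s \in split4 t ->
  homothetic A B C (r / 2) s \/ homothetic A B C (- (r / 2)) s.
Proof.
have eq3 P Q U P' Q' U' : P = P' -> Q = Q' -> U = U' -> (P, Q, U) = (P', Q', U').
  by move=> -> -> ->.
move=> [W [] ->]; rewrite /split4 !inE => /or4P[] /eqP ->.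
- by left; exists (W + (r / 2) *: A); apply: Or31; apply: eq3;
    apply: pair_ext; rewrite /midpoint !planeE; field.
- by left; exists (W + (r / 2) *: B); apply: Or31; apply: eq3;
    apply: pair_ext; rewrite /midpoint !planeE; field.
- by left; exists (W + (r / 2) *: C); apply: Or31; apply: eq3;
    apply: pair_ext; rewrite /midpoint !planeE; field.
- by right; exists (W + (r / 2) *: (A + B + C)); apply: Or33; apply: eq3;
    apply: pair_ext; rewrite /midpoint !planeE; field.
- by left; exists (W + (r / 2) *: B); apply: Or32; apply: eq3;
    apply: pair_ext; rewrite /midpoint !planeE; field.
- by left; exists (W + (r / 2) *: C); apply: Or32; apply: eq3;
    apply: pair_ext; rewrite /midpoint !planeE; field.
- by left; exists (W + (r / 2) *: A); apply: Or32; apply: eq3;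
    apply: pair_ext; rewrite /midpoint !planeE; field.
- by right; exists (W + (r / 2) *: (A + B + C)); apply: Or31; apply: eq3;
    apply: pair_ext; rewrite /midpoint !planeE; field.
- by left; exists (W + (r / 2) *: C); apply: Or33; apply: eq3;
    apply: pair_ext; rewrite /midpoint !planeE; field.
- by left; exists (W + (r / 2) *: A); apply: Or33; apply: eq3;
    apply: pair_ext; rewrite /midpoint !planeE; field.
- by left; exists (W + (r / 2) *: B); apply: Or33; apply: eq3;
    apply: pair_ext; rewrite /midpoint !planeE; field.
- by right; exists (W + (r / 2) *: (A + B + C)); apply: Or32; apply: eq3;
    apply: pair_ext; rewrite /midpoint !planeE; field.
Qed.

(** Each subdivision halves the ratio up to sign, so its square, the ratio of areas, is divided by
    4. *)
Lemma homothetic_subdivision k A B C t : t \in subdivision k A B C ->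
  exists2 r, homothetic A B C r t & r ^+ 2 = (4 ^+ k)^-1.
Proof.
elim: k t => [|k IH] t.
  rewrite inE => /eqP ->; exists 1; last by rewrite expr1n invr1.
  by exists 0; apply: Or31; rewrite !scale1r !add0r.
move=> /flatten_mapP[s /IH[r rs r2] /(homothetic_split4 rs)[tr|tr]].
  by exists (r / 2) => //; rewrite (exprS _ k) invfM -r2; field.
by exists (- (r / 2)) => //; rewrite (exprS _ k) invfM -r2; field.
Qed.

Lemma tri_homothetic A B C r t : homothetic A B C r t ->
  exists W, forall p, tri t p -> exists2 q, triangle A B C q & p = W + r *: q.
Proof.
move=> [W tE]; exists W => p tp.
have {tE tp} : triangle (W + r *: A) (W + r *: B) (W + r *: C) p.
  by case: tE tp => -> //; rewrite /tri /=; rewrite ?(triangle_cycle (W + r *: A)) // -triangle_cycle.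
move=> [w1 [w2 [w3 [? ? ? w_sum ->]]]].
exists (w1 *: A + w2 *: B + w3 *: C); first by exists w1, w2, w3; split.
have -> : w3 = 1 - w1 - w2 by lra.
by apply: pair_ext; rewrite !planeE; ring.
Qed.

Lemma subtriangleE k A B C i : subtriangle A B C k i =
  tri (nth (A, B, C) (subdivision k A B C) i).
Proof. by rewrite /subtriangle /tri; case: (nth _ _ _) => [[P Q] U]. Qed.

Lemma mem_subdivision k A B C i : (i < 4 ^ k)%N ->
  nth (A, B, C) (subdivision k A B C) i \in subdivision k A B C.
Proof. by move=> ik; rewrite mem_nth// size_subdivision. Qed.

Lemma subtriangle_cover k A B C p : triangle A B C p ->
  exists i : 'I_(4 ^ k), subtriangle A B C k i p.
Proof.
move=> /(triangle_subdivision k)[t /(nthP (A, B, C))[i ik <-] tp].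
by rewrite size_subdivision in ik; exists (Ordinal ik); rewrite subtriangleE.
Qed.

Lemma subtriangle_sub k A B C i : (i < 4 ^ k)%N ->
  subtriangle A B C k i `<=` triangle A B C.
Proof.
move=> ik p; rewrite subtriangleE => ?; apply/(triangle_subdivision k).
by exists (nth (A, B, C) (subdivision k A B C) i) => //; exact: mem_subdivision.
Qed.

Lemma subtriangle_nonempty k A B C i : subtriangle A B C k i !=set0.
Proof. by rewrite subtriangleE; eexists; exact: triangle_vertex. Qed.

End subdivision.

(** * Riemann sums *)

Section riemann.
Context {R : realType}.
Implicit Types (A B C p : R * R) (f : R * R -> R) (e mu M : R).

(** [f] need not attain its supremum on [S], so near-maximisers serve as the sample points of upper
    Riemann sums. *)
Lemma near_max (S : set (R * R)) f e M : 0 < e -> S !=set0 ->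
  (forall p, S p -> f p <= M) -> exists2 q, S q & forall p, S p -> f p <= f q + e.
Proof.
move=> e_gt0 [p0 Sp0] fM.
have fS : has_sup (f @` S).
  by split; [exists (f p0), p0|exists M => _ [p Sp <-]; exact: fM].
have [_ [q Sq <-] fq] := sup_adherent e_gt0 fS.
exists q => // p Sp; apply: (@le_trans _ _ (sup (f @` S))).
  by apply: sup_upper_bound => //; exists p.
by rewrite -lerBlDr ltW.
Qed.

Lemma riemann_meanN A B C f mu : riemann_mean A B C f mu ->
  riemann_mean A B C (fun p => - f p) (- mu).
Proof.
move=> fmu y /fmu ycvg.
rewrite (_ : (fun k => _) = - (fun k => (4 ^+ k)^-1 * \sum_(i < 4 ^ k) f (y k i))).
  exact: cvgN.
by apply/funext => k; rewrite sumrN mulrN.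
Qed.

Lemma upper_mean_riemann A B C (x : forall N, N.-tuple (R * R)) f mu M :
  (forall N (i : 'I_N), triangle A B C (tnth (x N) i)) ->
  (forall k i, (i < 4 ^ k)%N ->
     upper_mean x \1_(subtriangle A B C k i) (4 ^+ k)^-1) ->
  (forall p, triangle A B C p -> `|f p| <= M) ->
  riemann_mean A B C f mu -> upper_mean x f mu.
Proof.
move=> x_in xT fM fmu; apply: upper_mean_closed => _ /posnumP[e].
pose d := e%:num / 2.
have d_gt0 : 0 < d by rewrite divr_gt0.
(* The Riemann means take a whole array of sample points, so all levels are chosen at once; outside
   the index range the point is arbitrary. *)
have /choice[y yP] (ki : nat * nat) : exists q, (ki.2 < 4 ^ ki.1)%N ->
    subtriangle A B C ki.1 ki.2 q /\
    forall p, subtriangle A B C ki.1 ki.2 p -> f p <= f q + d.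
  have [kin|] := boolP (ki.2 < 4 ^ ki.1)%N; last by exists 0.
  have fM' p : subtriangle A B C ki.1 ki.2 p -> f p <= M.
    move=> /(subtriangle_sub kin) Op.
    by apply: le_trans (fM _ Op); exact: ler_norm.
  have [q Sq qP] := near_max d_gt0 (subtriangle_nonempty ki.1 A B C ki.2) fM'.
  by exists q.
have := fmu (fun k i => y (k, i)) (fun k i ik => (yP (k, i) ik).1).
(* A single level [k] is enough, one whose Riemann sum at the near-maximisers is within [d] of
   [mu]. *)
move=> /cvgrPdist_le /(_ _ d_gt0)[k _ /(_ k (leqnn k)) /= kmu].
(* Adding [M] makes the weights nonnegative, as [upper_meanZ] demands; the mean of the constant
   [- M] removes it again. *)
have M_ge i : (i < 4 ^ k)%N -> 0 <= f (y (k, i)) + d + M.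
  move=> ik; have := fM _ (subtriangle_sub ik (yP (k, i) ik).1).
  by rewrite ler_norml => /andP[? _]; have := d_gt0; lra.
have fT : upper_mean x
    (fun p => \sum_(i < 4 ^ k) (f (y (k, val i)) + d + M) * \1_(subtriangle A B C k i) p)
    (\sum_(i < 4 ^ k) (f (y (k, val i)) + d + M) * (4 ^+ k)^-1).
  apply: upper_mean_sum => i; apply: upper_meanZ; first exact/M_ge/ltn_ord.
  exact/xT/ltn_ord.
have := upper_meanD fT (upper_mean_cst x (- M)); apply: (upper_mean_le x_in).
  move=> p Op; rewrite lerBrDr; have [i Ti] := subtriangle_cover k Op.
  (* Other triangles may contain [p] on a common edge, but their terms are nonnegative. *)
  rewrite (bigD1 i)//= indicE mem_set// mulr1.
  have := (yP (k, val i) (ltn_ord i)).2 p Ti => /= fp.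
  apply: (@le_trans _ _ (f (y (k, val i)) + d + M)); first by rewrite lerD2r.
  by rewrite lerDl sumr_ge0// => j _; rewrite mulr_ge0 ?M_ge ?ltn_ord ?indicE.
have -> : \sum_(i < 4 ^ k) (f (y (k, val i)) + d + M) * (4 ^+ k)^-1 =
    (4 ^+ k)^-1 * (\sum_(i < 4 ^ k) f (y (k, val i))) + (d + M).
  rewrite -mulr_suml mulrC.
  have -> : \sum_(i < 4 ^ k) (f (y (k, val i)) + d + M) =
      (\sum_(i < 4 ^ k) f (y (k, val i))) + 4 ^+ k * (d + M).
    under eq_bigr do rewrite -addrA.
    by rewrite big_split/= sumr_const card_ord -[(d + M) *+ _]mulr_natl natrX.
  by rewrite mulrDr mulKf// expf_neq0.
(* One [d] is lost to the near-maximisers, the other to the Riemann sum. *)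
have ed : e%:num = d + d by rewrite -splitr.
by move: kmu; rewrite ler_norml ed => /andP[? _]; lra.
Qed.

End riemann.

(** * Convergence of the averages to the integral *)

Lemma coord_homothetic (R : realType) (A B C W q : R * R) (r : R) :
  det2 (A - C) (B - C) != 0 ->
  acoord A B C (W + r *: q) = acoord A B C (W + r *: C) + r * acoord A B C q /\
  bcoord A B C (W + r *: q) = bcoord A B C (W + r *: C) + r * bcoord A B C q.
Proof.
rewrite /acoord /bcoord /det2 !planeE => nz.
by split; field.
Qed.

Unset Implicit Arguments.

Theorem theorem6 (R : realType) (A B C : R * R) (f : R * R -> R)
    (x : forall N : nat, N.-tuple (R * R))
    (ABC_noncollinear : ~ collinear A B C)
    (f_integrable : riemann_integrable A B C f)
    (x_in : forall (N : nat) (i : 'I_N), triangle A B C (tnth (x N) i))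
    (discrepancy_to_0 :
       (fun N : nat => parallelogram_discrepancy A B C (x N)) @ \oo --> (0 : R)) :
  (fun N : nat => vol (triangle A B C) / N%:R * \sum_(i < N) f (tnth (x N) i))
    @ \oo --> riemann_integral A B C f.
Proof.
have ABC := det2_neq0 ABC_noncollinear.
case: f_integrable => -[M fM] [mu0 fmu0].
(* The limit [mu0] exists, so [xget] returns a limit of the Riemann means rather than its
   default. *)
have := @xgetI _ 0 [set m | riemann_mean A B C f m] mu0 fmu0.
rewrite /riemann_integral; set mu := xget _ _ => fmu.
rewrite (_ : (fun N => _) = fun N => mean x f N * vol (triangle A B C)); last first.
  by apply/funext => N; rewrite /mean -mulrA mulrC.
(* If [vol] takes the value 0, both sides vanish. *)
have [-> |vol_neq0] := eqVneq (vol (triangle A B C)) 0.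
  rewrite mulr0 (_ : (fun N => _) = fun=> 0); first exact: cvg_cst.
  by apply/funext => N; rewrite mulr0.
have xT k i : (i < 4 ^ k)%N ->
    upper_mean x \1_(subtriangle A B C k i) (4 ^+ k)^-1.
  move=> ik; have [r rt <-] := homothetic_subdivision (mem_subdivision A B C ik).
  rewrite subtriangleE.
  set t := nth _ _ _ in rt *.
  have [W WE] : exists W, forall p, tri t p -> exists2 q, triangle A B C q & p = W + r *: q.
    exact: tri_homothetic.
  (* The homothety sends the origin [C] of the frame to [W + r C], whose coordinates are the
     offsets. *)
  apply: (upper_mean_homothetic ABC x_in discrepancy_to_0 vol_neq0
    (a := acoord A B C (W + r *: C)) (b := bcoord A B C (W + r *: C))).
  move=> _ /WE[q /(triangleE ABC)[? ? ?] ->]; exists (acoord A B C q), (bcoord A B C q).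
  by have [] := coord_homothetic W q r ABC.
apply: cvgMl; apply: (upper_mean_cvg (c := mu)).
  exact: (upper_mean_riemann x_in xT fM).
apply: (upper_mean_riemann (M := M) x_in xT); last exact: riemann_meanN.
by move=> p /fM; rewrite normrN.
Qed.
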